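(* Let $S$ be a semigroup with zero such that $Z(S)\neq S$, $|Z(S)^{*}|\geq 2$, and every zero divisor of $S$ is a two-sided zero divisor. Then $\overrightarrow{\Gamma}_{E}(S)$ and $\overrightarrow{\mathrm{AG}}(S)$ are connected. Moreover, $$\mathrm{Diam}(\overrightarrow{\mathrm{AG}}(S))\leq\mathrm{Diam}(\overrightarrow{\Gamma}(S))\leq 3\quad\text{and}\quad \mathrm{Diam}(\overrightarrow{\Gamma}_{E}(S))\leq\mathrm{Diam}(\overrightarrow{\Gamma}(S))\leq 3.$$
   Context: Let $S$ be a semigroup with zero, not necessarily commutative; for $A\subseteq S$, $A^{*}=A\setminus\{0\}$. An element $x\in S$ is a left (resp. right) zero divisor if $xy=0$ (resp. $yx=0$) for some $y\in S^{*}$; $Z(S)$ is the set of all elements that are left or right zero divisors (the zero divisors of $S$), and a two-sided zero divisor is an element that is both a left and a right zero divisor. For $x\in S$, $\mathrm{Ann}_{l}(x)=\{s\in S: sx=0\}$ and $\mathrm{Ann}_{r}(x)=\{s\in S: xs=0\}$. The following are simple digraphs (no loops, no multiple arcs), all with vertex set $Z(S)^{*}$; for distinct $x,y\in Z(S)^{*}$: (1) in the zero-divisor digraph $\overrightarrow{\Gamma}(S)$, $x\to y$ is an arc iff $xy=0$; (2) in the extended zero-divisor digraph $\overrightarrow{\Gamma}_{E}(S)$, $x\to y$ is an arc iff $x^{n}y^{m}=0$ for some positive integers $n,m$ with $x^{n}\neq 0$ and $y^{m}\neq 0$; (3) in the annihilator digraph $\overrightarrow{\mathrm{AG}}(S)$,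 $x\to y$ is an arc iff $\mathrm{Ann}_{l}(xy)\setminus(\mathrm{Ann}_{l}(x)\cup\mathrm{Ann}_{l}(y))\neq\emptyset$ or $\mathrm{Ann}_{r}(xy)\setminus(\mathrm{Ann}_{r}(x)\cup\mathrm{Ann}_{r}(y))\neq\emptyset$. A digraph is connected if for every two distinct vertices $x,y$ there is a directed path from $x$ to $y$. The directed distance from $x$ to $y$ is the length of a shortest directed path from $x$ to $y$ ($\infty$ if none exists), and $\mathrm{Diam}$ is the greatest directed distance between vertices. *)

(* Defs.v *)
From HB Require Import structures.
From mathcomp Require Import all_boot all_order all_algebra.
From mathcomp Require Import boolp classical_sets functions cardinality.
From mathcomp Require Import constructive_ereal.

Set Implicit Arguments.
Unset Strict Implicit.
Unset Printing Implicit Defensive.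

Import Order.TTheory GRing.Theory Num.Theory.
Local Open Scope classical_set_scope.

HB.mixin Record Semigroup_hasZero S of Semigroup S := {
  szero : S;
  smul0 : left_zero szero ( *%g : S -> S -> S);
  smuls0 : right_zero szero ( *%g : S -> S -> S)
}.

#[short(type="semigroup0Type")]
HB.structure Definition Semigroup0 := {S of Semigroup_hasZero S & Semigroup S}.

Record digraph (T : choiceType) := Digraph {
  vertex : set T;
  arc : rel T;
  arc_vertex : forall x y, arc x y -> vertex x /\ vertex y;
  arc_irr : irreflexive arc
}.

Section Digraph.
Variable T : choiceType.

Section Build.
Variables (V : set T) (r : T -> T -> Prop).

Definition digraph_arc : rel T :=
  fun x y => `[< [/\ V x, V y, x <> y & r x y] >].

Fact digraph_arc_vertex x y : digraph_arc x y -> V x /\ V y.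
Proof. by move=> /asboolP[]. Qed.

Fact digraph_arc_irr : irreflexive digraph_arc.
Proof. by move=> x; apply/negbTE/negP => /asboolP[]. Qed.

Definition digraph_of : digraph T :=
  Digraph digraph_arc_vertex digraph_arc_irr.

End Build.

Variable G : digraph T.

(* The path x :: p has length size p (its number of arcs). *)
Definition dipath (x y : T) (p : seq T) : Prop :=
  [/\ path (arc G) x p, last x p = y & uniq (x :: p)].

Definition connected_digraph : Prop :=
  forall x y, vertex G x -> vertex G y -> x <> y -> exists p, dipath x y p.

(* Lengths live in \bar int; the infimum is a minimum, or +oo when there is no
   path (see didistP). *)
Definition didist (x y : T) : \bar int :=
  infimum +oo%E [set (size p)%:Z%:E%E | p in dipath x y].

(* Unbounded sets of distances have supremum +oo; see diam_isLub. *)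
Definition diam : \bar int :=
  supremum 0%:E%E [set didist x y | x in vertex G & y in vertex G].

Variant didist_spec (x y : T) : \bar int -> Prop :=
| DidistFin p of dipath x y p
    & (forall q, dipath x y q -> (size p <= size q)%N) :
    didist_spec x y (size p)%:Z%:E%E
| DidistInf of (forall p, ~ dipath x y p) : didist_spec x y +oo%E.

Lemma didistP x y : didist_spec x y (didist x y).
Proof.
have [[p xyp]|nop] := pselect (exists p, dipath x y p); last first.
  have no q : ~ dipath x y q by move=> xyq; apply: nop; exists q.
  rewrite /didist (_ : [set _ | _ in _] = set0).
    by rewrite /infimum eqxx; constructor.
  by apply/seteqP; split=> // e [q /no].
have exn : exists n, `[< exists2 q, dipath x y q & size q = n >].
  by exists (size p); apply/asboolP; exists p.
case: (ex_minnP exn) => n /asboolP[q xyq <-] minq.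
have {}minq q' : dipath x y q' -> (size q <= size q')%N.
  by move=> xyq'; apply: minq; apply/asboolP; exists q'.
suff -> : didist x y = (size q)%:Z%:E%E by constructor.
set A := [set (size p)%:Z%:E%E | p in dipath x y].
have Aq : A (size q)%:Z%:E%E by exists q.
have infA : infimums A (size q)%:Z%:E%E.
  split=> [_ [q' /minq le_qq' <-]|e]; last exact.
  by rewrite lee_fin lez_nat.
rewrite /didist -/A /infimum ifF; last by apply/negbTE/set0P; exists (size q)%:Z%:E%E.
case: xgetP => [e _ infe|/(_ _ infA)//].
exact: is_subset1_infimums infe infA.
Qed.

Lemma diam_isLub : vertex G !=set0 ->
  isLub [set didist x y | x in vertex G & y in vertex G] diam.
Proof.
move=> [x0 Vx0]; set A := [set _ | _ in _ & _ in _].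
have A0 : A (didist x0 x0) by exists x0 => //; exists x0.
suff [e [ube lbe]] : supremums A !=set0.
  rewrite /diam -/A /supremum ifF; last by apply/negbTE/set0P; exists (didist x0 x0).
  by case: xgetP => [? _ []//|/(_ e) []].
have [[n ubn]|nub] := pselect (exists n : nat, ubound A n%:Z%:E%E).
  have exn : exists n : nat, `[< ubound A n%:Z%:E%E >] by exists n; apply/asboolP.
  case: (ex_minnP exn) => {ubn}n /asboolP ubn minn.
  exists n%:Z%:E%E; split=> // -[z||] ubz.
  - have z0 : (0 <= z)%R.
      have := ubz _ A0; case: didistP => // p _ _; rewrite lee_fin.
      exact: le_trans.
    rewrite lee_fin; case: z z0 ubz => // m _ ubm.
    by rewrite lez_nat; apply: minn; apply/asboolP.
  - exact: leey.
  - by have := ubz _ A0; case: didistP.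
exists +oo%E; split=> [e _|[z||] ubz]; first exact: leey.
- case: nub; exists `|z|%N => e /ubz/le_trans; apply.
  by rewrite lee_fin abszE ler_norm.
- exact: lexx.
- by have := ubz _ A0; case: didistP.
Qed.

End Digraph.

Local Open Scope group_scope.
Local Notation "0" := szero : group_scope.

Section ZeroDivisors.
Variable S : semigroup0Type.
Implicit Types x y s : S.

Definition left_zero_divisor x := exists2 y, y <> 0 & x * y = 0.
Definition right_zero_divisor x := exists2 y, y <> 0 & y * x = 0.

Definition zero_divisors : set S :=
  [set x | left_zero_divisor x \/ right_zero_divisor x].

Definition zero_divisors_star : set S := zero_divisors `\ (0 : S).

Definition Annl x : set S := [set s | s * x = 0].
Definition Annr x : set S := [set s | x * s = 0].

(* S has no unit: spow x n is the product of n copies of x for 0 < n only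
   (the junk value at n = 0 is x). *)
Definition spow x n : S := iterop n *%g x x.

Definition zero_divisor_digraph : digraph S :=
  digraph_of zero_divisors_star (fun x y => x * y = 0).

Definition extended_zero_divisor_digraph : digraph S :=
  digraph_of zero_divisors_star (fun x y => exists n m : nat,
    [/\ (0 < n)%N, (0 < m)%N, spow x n * spow y m = 0,
        spow x n <> 0 & spow y m <> 0]).

Definition annihilator_digraph : digraph S :=
  digraph_of zero_divisors_star (fun x y =>
    Annl (x * y) `\` (Annl x `|` Annl y) !=set0 \/
    Annr (x * y) `\` (Annr x `|` Annr y) !=set0).

End ZeroDivisors.

Arguments zero_divisors S : clear implicits.
Arguments zero_divisors_star S : clear implicits.
Arguments zero_divisor_digraph S : clear implicits.
Arguments extended_zero_divisor_digraph S : clear implicits.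
Arguments annihilator_digraph S : clear implicits.

(* Main.v *)
Require Import Defs.
From mathcomp Require Import all_boot all_order all_algebra.
From mathcomp Require Import boolp classical_sets functions cardinality.
From mathcomp Require Import constructive_ereal.

(** The digraph Gamma (arcs [x * y = 0]) is a spanning subdigraph of both
other digraphs, and passing to more arcs on the same vertices preserves
connectedness and can only shrink distances and the diameter
([connected_digraph_sub], [diam_sub]). It therefore suffices to show that Gamma
is connected with diameter at most 3, and that its arcs are arcs of the other
two.

For Gamma, let [x], [y] be vertices. As zero divisors are two-sided, there are
nonzero [a], [b] with [x * a = 0] and [b * y = 0]. If [a * b = 0], then
[x -> a -> b -> y] works; otherwise [a * b] is a vertex and
[x -> a * b -> y] works ([walk_zero_divisor_digraph]). Repetitions among these
vertices only shorten the walk, and a walk contains a path with the same ends.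

An arc of Gamma is one of Gamma_E with both exponents equal to 1. It is one of
AG because the left annihilator of [x * y = 0] is all of [S]: an element that is
not a zero divisor lies in it, but annihilates neither [x] nor [y]
([arc_annihilator_digraph]). *)

Set Implicit Arguments.
Unset Strict Implicit.
Unset Printing Implicit Defensive.

Import Order.TTheory.
Local Open Scope classical_set_scope.

(** * Walks, distances and spanning subdigraphs *)

Section Walk.
Variables (T : choiceType) (G : digraph T).

(** Unlike [dipath], walks may repeat vertices, and [n] is only an upper bound
on the length: this lets walks be concatenated, and a step from a vertex to
itself count as a walk of length at most 1 although a digraph has no loops. *)
Definition walk_le (n : nat) (x y : T) : Prop :=
  exists p, [/\ path (Defs.arc G) x p, last x p = y & (size p <= n)%N].

Lemma walk_le_trans m n x y z :
  walk_le m x y -> walk_le n y z -> walk_le (m + n) x z.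
Proof.
move=> [p [xp <- pm]] [q [yq <- qn]]; exists (p ++ q).
by rewrite cat_path xp yq last_cat size_cat leq_add.
Qed.

Lemma walk_le_widen m n x y : (m <= n)%N -> walk_le m x y -> walk_le n x y.
Proof. by move=> mn [p [? ? pm]]; exists p; split=> //; apply: leq_trans mn. Qed.

Lemma walk_le_dipath n x y :
  walk_le n x y -> exists2 p, dipath G x y p & (size p <= n)%N.
Proof.
move=> [p [+ + pn]]; case/shortenP => q xq uq sub_qp lastq.
exists q => //; apply: leq_trans pn; apply: uniq_leq_size sub_qp.
by case/andP: uq.
Qed.

Lemma didist_le n x y : walk_le n x y -> (didist G x y <= n%:Z%:E)%E.
Proof.
move=> /walk_le_dipath[p xyp pn]; case: didistP => [q _ /(_ p xyp) qp|/(_ p)//].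
by rewrite lee_fin lez_nat (leq_trans qp).
Qed.

Lemma diam_le n : vertex G !=set0 ->
  (forall x y, vertex G x -> vertex G y -> walk_le n x y) ->
  (diam G <= n%:Z%:E)%E.
Proof.
move=> G0 walkG; have [_] := diam_isLub G0; apply.
by move=> _ [x Gx [y Gy <-]]; apply/didist_le/walkG.
Qed.

End Walk.

Section SpanningSubdigraph.
Variables (T : choiceType) (G H : digraph T).
Hypotheses (eqV : vertex G = vertex H) (subA : subrel (Defs.arc G) (Defs.arc H)).

Lemma dipath_sub x y p : dipath G x y p -> dipath H x y p.
Proof. by case=> xp lastp up; split=> //; apply: sub_path xp. Qed.

Lemma connected_digraph_sub : connected_digraph G -> connected_digraph H.
Proof.
move=> conG x y; rewrite -eqV => Gx Gy /(conG _ _ Gx Gy)[p /dipath_sub xyp].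
by exists p.
Qed.

Lemma didist_sub x y : (didist H x y <= didist G x y)%E.
Proof.
case: (didistP G) => [p /dipath_sub[xp lastp _] _|_]; last exact: leey.
by apply: didist_le; exists p.
Qed.

Lemma diam_sub : vertex G !=set0 -> (diam H <= diam G)%E.
Proof.
move=> G0; have [ubG _] := diam_isLub G0.
have [|_] := @diam_isLub _ H; first by rewrite -eqV.
apply=> _ [x Hx [y Hy <-]]; apply: le_trans (didist_sub x y) _.
by apply: ubG; exists x; rewrite ?eqV//; exists y; rewrite ?eqV.
Qed.

End SpanningSubdigraph.

(** * Zero-divisor digraphs *)

Section ZeroDivisorDigraphs.
Local Open Scope group_scope.
Local Notation "0" := szero : group_scope.

Variable S : semigroup0Type.
Implicit Types x y : S.

Let Gamma := zero_divisor_digraph S.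

Lemma zero_divisors_starl x y :
  x <> 0 -> y <> 0 -> x * y = 0 -> zero_divisors_star S x.
Proof. by move=> x0 y0 xy0; split=> //; left; exists y. Qed.

Lemma zero_divisors_starr x y :
  x <> 0 -> y <> 0 -> x * y = 0 -> zero_divisors_star S y.
Proof. by move=> x0 y0 xy0; split=> //; right; exists x. Qed.

Lemma walk_zero_product x y :
  x <> 0 -> y <> 0 -> x * y = 0 -> walk_le Gamma 1 x y.
Proof.
move=> x0 y0 xy0; have [->|/eqP xy] := eqVneq x y; first by exists [::].
exists [:: y]; split=> //=; rewrite andbT; apply/asboolP; split=> //.
- exact: zero_divisors_starl xy0.
- exact: zero_divisors_starr xy0.
Qed.

(** Annihilation on one side gives a step from [x] to some [a] and a step from
some [b] to [y]. Either [a * b = 0] closes the gap, or the nonzero product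
[a * b] inherits [x * (a * b) = 0 = (a * b) * y] and replaces both. *)
Lemma walk_zero_divisor_digraph x y : x <> 0 -> y <> 0 ->
  left_zero_divisor x -> right_zero_divisor y -> walk_le Gamma 3 x y.
Proof.
move=> x0 y0 [a a0 xa0] [b b0 by0]; have [ab0|ab0] := pselect (a * b = 0).
  apply: walk_le_trans (walk_zero_product x0 a0 xa0) _.
  apply: (@walk_le_trans _ _ 1 1) (walk_zero_product a0 b0 ab0) _.
  exact: walk_zero_product.
apply: (@walk_le_widen _ _ (1 + 1)) => //; apply: (@walk_le_trans _ _ _ _ _ (a * b)).
  by apply: walk_zero_product => //; rewrite mulgA xa0 smul0.
by apply: walk_zero_product => //; rewrite -mulgA by0 smuls0.
Qed.

Lemma arc_extended_zero_divisor_digraph :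
  subrel (Defs.arc Gamma) (Defs.arc (extended_zero_divisor_digraph S)).
Proof.
move=> x y /asboolP[Zx Zy xy xy0]; apply/asboolP; split=> //.
by exists 1%N, 1%N; split=> //; [case: Zx | case: Zy].
Qed.

(** [Z(S) <> S] is what separates the annihilator of [x * y = 0], which is all
of [S], from those of [x] and [y], which consist of zero divisors. *)
Lemma arc_annihilator_digraph : zero_divisors S <> [set: S] ->
  subrel (Defs.arc Gamma) (Defs.arc (annihilator_digraph S)).
Proof.
move=> /eqP/setTPn[s Ns] x y /asboolP[Zx Zy xy xy0]; apply/asboolP; split=> //.
left; exists s; split; first by rewrite /Annl /= xy0 smuls0.
by case=> sx0; apply: Ns; left; [exists x | exists y] => //; [case: Zx | case: Zy].
Qed.

Section TwoSided.
Hypothesis two_sided : forall x,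
  zero_divisors S x -> left_zero_divisor x /\ right_zero_divisor x.

Lemma walk_zero_divisor_digraph_vertex x y :
  vertex Gamma x -> vertex Gamma y -> walk_le Gamma 3 x y.
Proof.
move=> [/two_sided[lx _] x0] [/two_sided[_ ry] y0].
exact: walk_zero_divisor_digraph.
Qed.

Lemma connected_zero_divisor_digraph : connected_digraph Gamma.
Proof.
move=> x y Zx Zy _.
have [p xyp _] := walk_le_dipath (walk_zero_divisor_digraph_vertex Zx Zy).
by exists p.
Qed.

End TwoSided.
End ZeroDivisorDigraphs.

Theorem proposition5p2 (S : semigroup0Type)
    (properZ : zero_divisors S <> [set: S])
    (card_Z : (`I_2 #<= zero_divisors_star S)%card)
    (two_sided : forall x : S, zero_divisors S x ->
       left_zero_divisor x /\ right_zero_divisor x) :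
  [/\ connected_digraph (extended_zero_divisor_digraph S),
      connected_digraph (annihilator_digraph S),
      (diam (annihilator_digraph S) <= diam (zero_divisor_digraph S))%E
        /\ (diam (zero_divisor_digraph S) <= 3%:Z%:E)%E
    & (diam (extended_zero_divisor_digraph S) <= diam (zero_divisor_digraph S))%E
        /\ (diam (zero_divisor_digraph S) <= 3%:Z%:E)%E].
Proof.
have Z0 : zero_divisors_star S !=set0.
  apply/set0P/negP => /eqP Z0; move: card_Z; rewrite Z0 => /card_le0P.
  by move=> /seteqP[/(_ 0%N erefl)].
have conG := connected_zero_divisor_digraph two_sided.
have diamG := @diam_le _ (zero_divisor_digraph S) 3 Z0
  (walk_zero_divisor_digraph_vertex two_sided).
have subE := @arc_extended_zero_divisor_digraph S.
have subA := arc_annihilator_digraph properZ.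
by split; [apply: connected_digraph_sub subE conG
          |apply: connected_digraph_sub subA conG
          |split=> //; apply: diam_sub subA Z0
          |split=> //; apply: diam_sub subE Z0].
Qed.
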